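(* Let $\Omega \subset \mathbb{RP}^n$ be a strictly convex divisible domain. Then for any $x_0 \in \Omega$, the space $\big(\Omega, M_\Omega(x_0,\cdot)\big)$ is $\beta$-uniformly convex for some $\beta \in [2,\infty)$. That is, there exist $\beta \in [2,\infty)$ and $C>0$ such that, writing $\|v\| := M_\Omega(x_0,v)$, the modulus of convexity $$\delta(\varepsilon) = \inf\Big\{\,1 - \tfrac{\|x+y\|}{2} \;:\; \|x\|\le 1,\ \|y\|\le 1,\ \|x-y\|\ge \varepsilon \Big\}$$ satisfies $\delta(\varepsilon) \ge C\varepsilon^\beta$ for all $\varepsilon \in [0,2]$.
   Context: A subset $\Omega \subset \mathbb{RP}^n$ is properly convex if its closure is contained in some affine chart $\mathbb{R}^n \subset \mathbb{RP}^n$ and it is convex there; it is strictly convex if moreover its boundary $\partial\Omega$ contains no nontrivial line segment. A divisible convex set (divisible domain) is a properly convex open subset $\Omega \subset \mathbb{RP}^n$ for which there exists a discrete group $\Gamma$ of projective transformations preserving $\Omega$ and acting cocompactly on $\Omega$. Working in an affine chart $\mathbb{R}^n$ containing $\overline{\Omega}$, for a basepoint $x_0 \in \Omega$ and a vector $v \in T_{x_0}\Omega \cong \mathbb{R}^n$, the Minkowski functional is $M_\Omega(x_0,v) := \inf\{a>0 : x_0 + \tfrac{1}{a}v \in \Omega\}$ (so vectors are based at $x_0$ and the unit ball of $M_\Omega(x_0,\cdot)$ is $\Omega$ translated so that $x_0$ is the origin). This functional is positively homogeneous but in general not symmetric; $\beta$-uniform convexity is defined for it by the modulus-of-convexity condition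 stated in the claim, with $\|\cdot\| = M_\Omega(x_0,\cdot)$. *)

(* Defs.v *)
From HB Require Import structures.
From mathcomp Require Import all_boot all_order all_algebra.
From mathcomp Require Import all_classical all_reals all_analysis.
Set Implicit Arguments. Unset Strict Implicit. Unset Printing Implicit Defensive.
Import Order.TTheory GRing.Theory Num.Theory.
Import numFieldNormedType.Exports.
Local Open Scope classical_set_scope.
Local Open Scope ring_scope.

Section Defs.
Variable R : realType.

(* Points of the affine chart R^n of RP^n are row vectors 'rV[R]_n. *)

(* A properly convex open set, seen in an affine chart containing its closure:
   nonempty, open, convex, bounded (closure compact inside the chart). *)
Definition convex_set_rV n (O : set 'rV[R]_n) : Prop :=
  forall x y (t : R), O x -> O y -> 0 <= t <= 1 -> O ((1 - t) *: x + t *: y).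

Definition properly_convex_open n (O : set 'rV[R]_n) : Prop :=
  O !=set0 /\ open O /\ convex_set_rV O /\
  exists M : R, forall x, O x -> `|x| <= M.

Definition strictly_convex n (O : set 'rV[R]_n) : Prop :=
  properly_convex_open O /\
  forall a b : 'rV[R]_n,
    (forall t : R, 0 <= t <= 1 -> (closure O `\` O) ((1 - t) *: a + t *: b)) ->
    a = b.

(* Homogenization of a point of the chart, and the projective action of a
   matrix A in GL(n+1) on it (row-vector convention: [x:1] |-> [x:1] A). *)
Definition homog n (x : 'rV[R]_n) : 'rV[R]_(n + 1) := row_mx x (const_mx 1).

Definition proj_last n (A : 'M[R]_(n + 1)) (x : 'rV[R]_n) : R :=
  rsubmx (homog x *m A) 0 0.

Definition proj_act n (A : 'M[R]_(n + 1)) (x : 'rV[R]_n) : 'rV[R]_n :=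
  (proj_last A x)^-1 *: lsubmx (homog x *m A).

Definition preserves n (A : 'M[R]_(n + 1)) (O : set 'rV[R]_n) : Prop :=
  (forall x, O x -> proj_last A x != 0 /\ O (proj_act A x)) /\
  (forall y, O y -> exists x, O x /\ proj_act A x = y).

(* A discrete group of projective transformations: PGL(n+1,R) is represented
   by SL^{+-}(n+1,R) = {|det| = 1} (which is {+-1} -> PGL); discreteness of
   the subgroup of PGL is equivalent to discreteness of its preimage. *)
Definition discrete_proj_group n (G : set 'M[R]_(n + 1)) : Prop :=
  G 1%:M /\
  (forall A, G A -> `|\det A| = 1) /\
  (forall A B, G A -> G B -> G (A *m B)) /\
  (forall A, G A -> G (invmx A)) /\
  (forall A, G A -> exists2 e : R, 0 < e &
     forall B, G B -> `|B - A| < e -> B = A).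

Definition divisible n (O : set 'rV[R]_n) : Prop :=
  properly_convex_open O /\
  exists G : set 'M[R]_(n + 1),
    discrete_proj_group G /\ (forall A, G A -> preserves A O) /\
    exists K : set 'rV[R]_n, compact K /\ K `<=` O /\
      O `<=` \bigcup_(A in G) (proj_act A @` K).

Definition minkowski_fun n (O : set 'rV[R]_n) (x0 v : 'rV[R]_n) : R :=
  inf [set a : R | 0 < a /\ O (x0 + a^-1 *: v)].

(* beta-uniform convexity of the (possibly asymmetric) functional N:
   the modulus of convexity delta(eps) = inf {1 - N(x+y)/2 : N x <= 1,
   N y <= 1, N (x - y) >= eps} satisfies delta(eps) >= C eps^beta on [0,2];
   stated by unfolding the infimum (empty infimum = +oo). *)
Definition uniformly_convex_pow n (N : 'rV[R]_n -> R) (beta : R) : Prop :=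
  exists2 C : R, 0 < C &
    forall eps : R, 0 <= eps <= 2 ->
    forall x y : 'rV[R]_n, N x <= 1 -> N y <= 1 -> eps <= N (x - y) ->
      C * powR eps beta <= 1 - N (x + y) / 2.

End Defs.

(* Main.v *)
Require Import Defs.
From HB Require Import structures.
From mathcomp Require Import all_boot all_order all_algebra.
From mathcomp Require Import all_classical all_reals all_analysis.
From mathcomp Require Import ring lra.
Import Order.TTheory GRing.Theory Num.Theory.
Import numFieldNormedType.Exports.
Local Open Scope classical_set_scope.
Local Open Scope ring_scope.

(** Let [f] be an affine functional, nonnegative on [O], with [f x0 = 1]. If the
    slab [f <= q ^ j] of [O] has diameter at most [D / 2 ^ j] for every [j], with
    [q] independent of [f], then taking for [f] a functional (almost) vanishing
    where the ray from [x0] through the midpoint of two points leaves [O] gives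
    uniform convexity with exponent [- log_2 q].

    The slabs shrink because, when [f a] and [f z] are small compared with [s],
    the point [m + 4 (a - z)], where [m = z + s (x0 - z)], is still in [O]: this
    bounds [|a - z|] by about half of the diameter of a thicker slab. To see that
    it is in [O], move [m] into the compact set [K] by a projective automorphism
    of [O]. Strict convexity and compactness make the images of [a] and [z] close
    to each other. The last coordinate of the automorphism is a positive affine
    functional on [O], which is therefore Lipschitz with a constant controlled by
    its value at the centre of a ball of [O]; so the homogeneous weights of [a]
    and [z] are also close, and [m + 4 (a - z)] is sent near [m]. *)

(** * Compactness, closures and balls *)

Lemma compact_sub_open_ball (R : realType) (V : normedModType R)
    (A U : set V) : compact A -> open U -> A `<=` U ->
  exists2 r : R, 0 < r & forall x v, A x -> `|v| <= r -> U (x + v).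
Proof.
move=> /compact_near_coveringP cA oU AU.
have /nbhs_normP[e /= e0 He] : \forall v \near (0 : V), A `<=` (fun x => U (x + v)).
  apply: (cA _ (nbhs (0 : V)) (fun v x => U (x + v))) => x Ax.
  have : (fun p : V * V => p.1 + p.2) @ nbhs (x, 0 : V) --> x + 0.
    by apply: cvgD; [exact: cvg_fst | exact: cvg_snd].
  by apply; rewrite /= addr0; apply: open_nbhs_nbhs; split => //; exact: AU.
exists (e / 2); first by rewrite divr_gt0.
move=> x v Ax ve; apply: He => //=.
by rewrite sub0r normrN (le_lt_trans ve)// ltr_pdivrMr// mulrDr mulr1 ltrDl.
Qed.

Lemma open_ball_norm (R : realType) (V : normedModType R) (U : set V) x :
  open U -> U x -> exists2 r : R, 0 < r & forall v, `|v| <= r -> U (x + v).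
Proof.
move=> oU Ux; have [|r r0 Hr] := compact_sub_open_ball _ _ [set x] U (@compact_set1 _ _) oU.
  by move=> _ ->.
by exists r => // v; exact: Hr.
Qed.

Lemma closure_normP (R : realType) (V : normedModType R) (A : set V) y :
  closure A y <-> forall e, 0 < e -> exists2 z, A z & `|y - z| < e.
Proof.
split=> [cy e e0|H B /nbhs_normP[e /= e0 eB]].
  have [z [Az zy]] := cy _ (nbhsx_ballx y e e0).
  by exists z => //; rewrite -ball_normE in zy.
by have [z Az yz] := H _ e0; exists z; split => //; apply: eB.
Qed.

Lemma compact_closure (R : realType) n (O : set 'rV[R]_n) (M : R) :
  (forall x, O x -> `|x| <= M) -> compact (closure O).
Proof.
move=> OM; apply: bounded_closed_compact; last exact: closed_closure.
exists (M + 1); split; first by rewrite num_real.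
move=> N MN x /= /closure_normP/(_ 1 ltr01)[z Oz xz].
have -> : x = (x - z) + z by rewrite subrK.
rewrite (le_trans (ler_normD _ _))// (le_trans _ (ltW MN))// addrC lerD//.
  exact: OM.
exact: ltW.
Qed.

(** * Open convex sets and separating hyperplanes *)

Section convex_open.
Context {R : realType} {n : nat} (O : set 'rV[R]_n).
Hypotheses (oO : open O) (cO : convex_set_rV O).

(** Replace [y] by a nearby [z] in [O]: the error [t *: (y - z)] is absorbed by a ball around [x],
    whose weight [1 - t] is positive. *)
Lemma convex_open_closure x y (t : R) :
  O x -> closure O y -> 0 <= t < 1 -> O ((1 - t) *: x + t *: y).
Proof.
move=> Ox cy /andP[t0 t1].
have [d d0 Hd] := open_ball_norm _ _ _ _ oO Ox.
have e0 : 0 < d * (1 - t) by rewrite mulr_gt0// subr_gt0.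
have [z Oz yz] := (closure_normP _ _ _ _).1 cy _ e0.
rewrite (_ : _ + _ = (1 - t) *: (x + (t / (1 - t)) *: (y - z)) + t *: z).
  apply: cO => //; last by rewrite t0 ltW.
  apply: Hd; rewrite normrZ ger0_norm; last by rewrite divr_ge0// subr_ge0 ltW.
  rewrite mulrAC ler_pdivrMr ?subr_gt0//.
  apply: le_trans (ltW yz); rewrite ler_piMl// ltW//.
by apply/rowP => i; rewrite !mxE; field; rewrite subr_eq0 gt_eqF.
Qed.

Lemma closure_convex : convex_set_rV (closure O).
Proof.
move=> x y t cx cy /andP[t0 t1]; apply/closure_normP => e e0.
have [x' Ox' xx'] := (closure_normP _ _ _ _).1 cx _ e0.
have [y' Oy' yy'] := (closure_normP _ _ _ _).1 cy _ e0.
exists ((1 - t) *: x' + t *: y'); first by apply: cO => //; rewrite t0.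
rewrite opprD addrACA -!scalerBr (le_lt_trans (ler_normD _ _))// !normrZ.
rewrite !ger0_norm ?subr_ge0//.
have [->|tn1] := eqVneq t 1; first by rewrite subrr mul0r mul1r add0r.
have t1' : 0 < 1 - t by rewrite subr_gt0 lt_neqAle tn1.
nra.
Qed.

(* Minimising the Euclidean distance to [e] over the compact [closure O]
   produces the normal vector of a separating hyperplane through [e]. *)
Lemma convex_open_separation (x0 e : 'rV[R]_n) :
  (exists M : R, forall x, O x -> `|x| <= M) -> O x0 -> ~ closure O e ->
  exists L : 'cV[R]_(n + 1),
    [/\ forall x, O x -> 0 <= (homog x *m L) 0 0,
        (homog x0 *m L) 0 0 = 1 & (homog e *m L) 0 0 = 0].
Proof.
move=> [M OM] Ox0 ncle.
pose dot (u v : 'rV[R]_n) := \sum_i u 0 i * v 0 i.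
have cK := compact_closure _ _ _ _ OM.
have cdot : continuous (fun x : 'rV[R]_n => dot (x - e) (x - e)).
  apply: continuous_big => [p|i _ x].
    by apply: cvgD; [exact: cvg_fst | exact: cvg_snd].
  have c1 : (fun y : 'rV[R]_n => (y - e) 0 i) @ x --> (x - e) 0 i.
    apply: (@continuous_comp _ _ _ (fun y : 'rV[R]_n => y - e)
        (fun M : 'rV[R]_n => M 0 i)).
      by apply: continuousB; [move=> ? | exact: cst_continuous].
    exact: coord_continuous.
  exact: (cvgM c1 c1).
have [||p /set_mem clp pmin] := @compact_EVT_min _ _ (fun x : 'rV[R]_n => dot (x - e) (x - e)) _ _ cK.
- by exists x0; exact: subset_closure.
- exact: continuous_subspaceT.
have dotDl u v w : dot (u + v) w = dot u w + dot v w.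
  by rewrite -big_split; apply: eq_bigr => i _; rewrite mxE mulrDl.
have dotZl k u w : dot (k *: u) w = k * dot u w.
  by rewrite mulr_sumr; apply: eq_bigr => i _; rewrite mxE mulrA.
have dotC u v : dot u v = dot v u by apply: eq_bigr => i _; rewrite mulrC.
have dotsq (t : R) u w : dot (t *: u + w) (t *: u + w) =
    t * (2 * dot u w + t * dot u u) + dot w w.
  rewrite dotDl dotZl (dotC u) (dotC w) !dotDl !dotZl (dotC w u).
  ring.
have dot_ge0 u : 0 <= dot u u by apply: sumr_ge0 => i _; exact: sqr_ge0.
have pe : 0 < dot (p - e) (p - e).
  rewrite lt_neqAle dot_ge0 andbT eq_sym; apply/eqP => /eqP.
  rewrite psumr_eq0 => [/allP pe0|i _]; last exact: sqr_ge0.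
  apply: ncle; suff <- : p = e by [].
  apply/rowP => i; apply/eqP; rewrite -subr_eq0.
  by have := pe0 i (mem_index_enum _); rewrite /= mulf_eq0 orbb !mxE.
(* Moving from the nearest point [p] a fraction [t] towards [x] cannot decrease the squared distance
   to [e]; divide by [t]. *)
have xp x : O x -> 0 <= dot (x - p) (p - e).
  move=> Ox; set B := dot _ _; set Q := dot (x - p) (x - p).
  have H t : 0 < t <= 1 -> 0 <= 2 * B + t * Q.
    move=> /andP[t0 t1].
    have : closure O ((1 - (1 - t)) *: x + (1 - t) *: p).
      by apply: subset_closure; apply: convex_open_closure => //; lra.
    move=> /mem_set/pmin.
    have -> : (1 - (1 - t)) *: x + (1 - t) *: p - e = t *: (x - p) + (p - e).
      by apply/rowP => i; rewrite !mxE; ring.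
    rewrite dotsq -/Q -/B.
    move=> H.
    have : 0 <= t * (2 * B + t * Q) by lra.
    by rewrite pmulr_rge0.
  have Q0 : 0 <= Q by exact: dot_ge0.
  rewrite leNgt; apply/negP => B0.
  have BQ : 0 < - B + Q by lra.
  (* For [B < 0] this fraction gives [t * Q <= - B], hence [2 * B + t * Q < 0]. *)
  have := H (- B / (- B + Q)); rewrite divr_gt0 ?oppr_gt0//.
  rewrite ler_pdivrMr// mul1r lerDl Q0 => /(_ erefl).
  have : - B / (- B + Q) * Q <= - B.
    by rewrite mulrAC ler_pdivrMr//; nra.
  lra.
have x0pos : 0 < dot (x0 - e) (p - e).
  have -> : x0 - e = (x0 - p) + (p - e) by rewrite addrA subrK.
  by rewrite dotDl; have := xp _ Ox0; lra.
exists ((dot (x0 - e) (p - e))^-1 *: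
  col_mx (p - e)^T (const_mx (- dot e (p - e)))).
have E x : (homog x *m ((dot (x0 - e) (p - e))^-1 *:
    col_mx (p - e)^T (const_mx (- dot e (p - e))))) 0 0 =
    dot (x - e) (p - e) / dot (x0 - e) (p - e).
  rewrite -scalemxAr mxE mul_row_col mulrC; congr (_ / _).
  rewrite dotDl -scaleN1r dotZl mulN1r mxE; congr (_ + _).
    by rewrite mxE; apply: eq_bigr => i _; rewrite mxE.
  by rewrite mxE big_ord1 !mxE mul1r.
split=> [x Ox||].
- rewrite E divr_ge0 ?(ltW x0pos)//.
  have -> : x - e = (x - p) + (p - e) by rewrite addrA subrK.
  by rewrite dotDl addr_ge0 ?xp.
- by rewrite E divff// gt_eqF.
- by rewrite E subrr -(scale0r 0) dotZl !mul0r.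
Qed.

End convex_open.

(** * Strict convexity, made uniform by compactness *)

Section strictly_convex.
Context {R : realType} {n : nat} (O : set 'rV[R]_n).
Hypothesis sO : strictly_convex O.

(** If some point of the segment is in [O], the midpoint lies between it and the farther endpoint,
    hence in [O]. Otherwise the whole segment is in the boundary. *)
Lemma strictly_convex_midpoint a b :
  closure O a -> closure O b -> a != b -> O (2^-1 *: a + 2^-1 *: b).
Proof.
have [[_ [oO [cO _]]] sc] := sO.
move=> ca cb /eqP ab; apply: contrapT => nOc; apply: ab; apply: sc => t t01.
split; first exact: closure_convex.
move=> Od; apply: nOc; have [t2|t2] := leP t 2^-1.
  have t1 : 0 < 1 - t by lra.
  rewrite (_ : _ + _ = (1 - ((1 - 2 * t) / (2 * (1 - t)))) *:
      ((1 - t) *: a + t *: b) + ((1 - 2 * t) / (2 * (1 - t))) *: b).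
    apply: convex_open_closure => //.
    by rewrite divr_ge0 ?ltr_pdivrMr/=; lra.
  by apply/rowP => i; rewrite !mxE; field; rewrite gt_eqF.
have t0 : 0 < t by lra.
rewrite (_ : _ + _ = (1 - (1 - (2 * t)^-1)) *:
    ((1 - t) *: a + t *: b) + (1 - (2 * t)^-1) *: a).
  apply: convex_open_closure => //; rewrite subr_ge0 invf_le1 ?gtrBl ?invr_gt0; lra.
by apply/rowP => i; rewrite !mxE; field; rewrite gt_eqF.
Qed.

(** The pairs of [closure O] at distance at least [eta] form a compact set, so their midpoints form
    a compact subset of [O]. *)
Lemma strictly_convex_midpoint_ball (eta : R) : 0 < eta ->
  exists2 r : R, 0 < r & forall a b v, O a -> O b -> eta <= `|a - b| ->
    `|v| <= r -> O (2^-1 *: a + 2^-1 *: b + v).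
Proof.
have [[_ [oO [cO [M OM]]]] _] := sO.
move=> eta0.
have cK := compact_closure _ _ _ _ OM.
pose V := ('rV[R]_n * 'rV[R]_n)%type.
pose E := (closure O `*` closure O) `&` [set p : V | eta <= `|p.1 - p.2|].
have cE : compact E.
  rewrite /E setIC.
  apply: subclosed_compact (compact_setX cK cK) _; last by move=> ? [].
  apply: closedI; last exact: (compact_closed _ (compact_setX cK cK)).
  apply: (@closed_comp _ _ (fun p : V => `|p.1 - p.2|) [set x : R | eta <= x]).
    move=> p _; apply: (@continuous_comp _ _ _ (fun p : V => p.1 - p.2)).
      by apply: cvgB; [exact: cvg_fst | exact: cvg_snd].
    exact: norm_continuous.
  exact: closed_ge.
pose mid (p : V) := 2^-1 *: p.1 + 2^-1 *: p.2.
have cmid : compact (mid @` E).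
  apply: continuous_compact => //; apply: continuous_subspaceT => p.
  apply: cvgD; apply: cvgZ; try exact: cvg_cst; [exact: cvg_fst|exact: cvg_snd].
have [|r r0 Hr] := compact_sub_open_ball _ _ _ O cmid oO.
  move=> _ [[a b] [[/= ca cb] ab] <-]; apply: strictly_convex_midpoint => //.
  by apply/eqP => /= abE; move: ab; rewrite /= abE subrr normr0 leNgt eta0.
exists r => // a b v Oa Ob ab; apply: Hr; exists (a, b) => //.
by split => //; split; exact: subset_closure.
Qed.

End strictly_convex.

(** * Affine functionals that are nonnegative on [O] *)

Section affine.
Context {R : realType} {n : nat}.
Implicit Types (x y z k : 'rV[R]_n) (O : set 'rV[R]_n) (L : 'cV[R]_(n + 1)).

(** A linear form on homogeneous coordinates, so that a projective map [A] pulls [L] back to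
    [A *m L], up to a scalar factor at each point. *)
Definition affine_eval L x : R := (homog x *m L) 0 0.

Lemma homog_shift k x y (t : R) :
  homog (k + t *: (x - y)) = homog k + t *: (homog x - homog y).
Proof.
rewrite /homog opp_row_mx add_row_mx scale_row_mx add_row_mx subrr.
by rewrite scaler0 addr0.
Qed.

Lemma affine_shift L k x y (t : R) : affine_eval L (k + t *: (x - y)) =
  affine_eval L k + t * (affine_eval L x - affine_eval L y).
Proof.
by rewrite /affine_eval homog_shift mulmxDl -scalemxAl mulmxBl !mxE.
Qed.

(** A step of length [r] from [k] along either direction of the line [x y] stays in [O], so it
    cannot lower the functional by more than its value at [k]. *)
Lemma affine_nonneg_lipschitz O L k (r : R) :
  (forall x, O x -> 0 <= affine_eval L x) -> 0 < r ->
  (forall v, `|v| <= r -> O (k + v)) ->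
  forall x y, `|affine_eval L x - affine_eval L y| <= affine_eval L k / r * `|x - y|.
Proof.
move=> L0 r0 kr x y.
have [->|xy] := eqVneq x y; first by rewrite !subrr !normr0 mulr0.
have d0 : 0 < `|x - y| by rewrite normr_gt0 subr_eq0.
have H u v : u - v = x - y \/ u - v = y - x ->
    affine_eval L v - affine_eval L u <= affine_eval L k / r * `|x - y|.
  move=> uv; have E : `|u - v| = `|x - y| by case: uv => -> //; rewrite distrC.
  have : 0 <= affine_eval L (k + (r / `|x - y|) *: (u - v)).
    apply/L0/kr; rewrite normrZ E ger0_norm; last by rewrite divr_ge0 ?ltW.
    by rewrite divfK// gt_eqF.
  rewrite affine_shift => Hk.
  rewrite mulrAC ler_pdivlMr//.
  suff : 0 <= (affine_eval L k + r / `|x - y| *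
      (affine_eval L u - affine_eval L v)) * `|x - y| by
    rewrite mulrDl mulrAC divfK ?gt_eqF//; lra.
  by apply: mulr_ge0 => //; exact: ltW.
by rewrite ler_norml lerNl opprB !H; [|right|left].
Qed.

(** The midpoint [c] of [a] and [z] can be pushed away from [m] without leaving [O]; nonnegativity
    there bounds the value at [c] from below. *)
Lemma strictly_convex_affine O (D eta : R) : strictly_convex O ->
  (forall x y, O x -> O y -> `|x - y| <= D) -> 0 < eta ->
  exists2 t : R, 0 < t & forall L, (forall x, O x -> 0 <= affine_eval L x) ->
    forall a z m, O a -> O z -> O m -> eta <= `|a - z| ->
    t * affine_eval L m <= affine_eval L a + affine_eval L z.
Proof.
move=> sO OD eta0.
have [r r0 Hr] := strictly_convex_midpoint_ball O sO _ eta0.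
have [_ [_ [cO _]]] := sO.1.
(* The denominator is positive whatever the sign of [D], and [t] times any distance in [O] is at
   most [r]. *)
pose t := r / (`|D| + 1).
have t0 : 0 < t by rewrite divr_gt0// ltr_pwDr.
exists (2 * t / (1 + t)); first by rewrite divr_gt0; lra.
move=> L L0 a z m Oa Oz Om az.
pose c := 2^-1 *: a + 2^-1 *: z.
have Oc : O c by rewrite -[c]addr0; apply: Hr => //; rewrite normr0 ltW.
have cE : affine_eval L c = (affine_eval L a + affine_eval L z) / 2.
  have -> : c = z + 2^-1 *: (a - z) by apply/rowP => i; rewrite !mxE; field.
  by rewrite affine_shift; field.
have : 0 <= affine_eval L (c + t *: (c - m)).
  apply/L0/Hr => //; rewrite normrZ (gtr0_norm t0) mulrAC ler_pdivrMr ?ltr_pwDr//.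
  rewrite (ler_wpM2l (ltW r0))// (le_trans (OD _ _ Oc Om))// (le_trans (ler_norm _))//.
  by rewrite lerDl.
rewrite affine_shift cE => H; rewrite mulrAC ler_pdivrMr; last lra.
lra.
Qed.

End affine.

(** * Projective maps and homogeneous weights *)

Section projective.
Context {R : realType} {n : nat}.
Implicit Types (x y z k : 'rV[R]_n) (O : set 'rV[R]_n) (A : 'M[R]_(n + 1)).

Lemma proj_lastE A x : proj_last A x = affine_eval (rsubmx A) x.
Proof. by rewrite /proj_last /affine_eval mulmx_rsub. Qed.

Lemma homog_mul A x : proj_last A x != 0 ->
  homog x *m A = proj_last A x *: homog (proj_act A x).
Proof.
move=> px; rewrite /homog scale_row_mx /proj_act scalerA mulfV// scale1r.
rewrite -{1}[_ *m A]hsubmxK; congr row_mx.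
apply/matrixP => i j; rewrite !ord1 !mxE mulr1.
by rewrite /proj_last !mxE.
Qed.

Lemma affine_eval_mul A (L : 'cV[R]_(n + 1)) x : proj_last A x != 0 ->
  affine_eval (A *m L) x = proj_last A x * affine_eval L (proj_act A x).
Proof. by move=> px; rewrite /affine_eval mulmxA homog_mul// -scalemxAl mxE. Qed.

Lemma proj_act_homog A x y (c : R) : c != 0 ->
  homog x *m A = c *: homog y -> proj_act A x = y.
Proof.
move=> c0 E; rewrite /proj_act /proj_last E /homog scale_row_mx row_mxKl row_mxKr.
by rewrite !mxE mulr1 scalerA mulVf// scale1r.
Qed.

(** The last coordinate is affine and has no zero on the convex set [O], so its sign is constant;
    [A] and [- A] act alike. *)
Lemma preserves_pos O A : convex_set_rV O -> A \in unitmx -> preserves A O ->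
  exists B, [/\ B \in unitmx, forall x, O x -> 0 < proj_last B x,
    preserves B O & forall x, proj_act B x = proj_act A x].
Proof.
move=> cO uA pA.
have lastN x : proj_last (- A) x = - proj_last A x.
  by rewrite /proj_last mulmxN !mxE.
have actN x : proj_act (- A) x = proj_act A x.
  rewrite /proj_act lastN mulmxN invrN scaleNr.
  by apply/rowP => i; rewrite !mxE mulrN opprK.
have pN : preserves (- A) O.
  split=> [x Ox|y Oy]; first by rewrite lastN oppr_eq0 actN; exact: pA.1.
  by have [x [Ox <-]] := pA.2 _ Oy; exists x; rewrite actN.
have [[x0 Ox0 x0neg]|allpos] :=
    pselect (exists2 x, O x & proj_last A x < 0); last first.
  exists A; split => // x Ox; rewrite lt_neqAle eq_sym (pA.1 _ Ox).1/=.
  by rewrite leNgt; apply/negP => xneg; apply: allpos; exists x.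
exists (- A); split => //; first by rewrite -scaleN1r unitmxZ ?unitrN1.
move=> x Ox; rewrite lastN oppr_gt0 ltNge; apply/negP => xpos.
have d0 : 0 < proj_last A x - proj_last A x0 by lra.
pose t := proj_last A x / (proj_last A x - proj_last A x0).
have Ot : O ((1 - t) *: x + t *: x0).
  by apply: cO => //; rewrite divr_ge0 ?ler_pdivrMr/=; lra.
have := (pA.1 _ Ot).1.
have -> : (1 - t) *: x + t *: x0 = x + t *: (x0 - x).
  by apply/rowP => i; rewrite !mxE; ring.
rewrite proj_lastE affine_shift -!proj_lastE.
by rewrite (_ : _ + _ = 0) ?eqxx// /t; field; rewrite gt_eqF.
Qed.

(* The value of [eta] is chosen so that the bounds below add up to a vector of
   norm at most [r] in [cocompact_enlarge]. *)
Lemma projective_weights (r D pa pz pm : R) : 0 < r -> 0 <= D ->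
  0 < pa -> 0 < pz -> 0 < pm -> pm <= 2 * pz ->
  let eta := r ^+ 2 / (64 * (r + D)) in
  `|pa - pz| <= pm / r * eta ->
  [/\ pm / pa <= 4, `|pm / pa - pm / pz| <= 8 * eta / r &
      2^-1 <= 1 + 4 * (pm / pa - pm / pz)].
Proof.
move=> r0 D0 pa0 pz0 pm0 pmz eta Hd.
have rD : 0 < r + D by lra.
(* Scale-free closeness of the weights: [h <= 1/64], so four times the bound [8 * h] is at most one
   half. *)
pose h := eta / r.
have h0 : 0 <= h by rewrite /h /eta !divr_ge0// ?mulr_ge0 ?sqr_ge0; lra.
have h64 : h <= 64^-1.
  rewrite /h /eta (_ : _ / r = r / (64 * (r + D))); last by field; lra.
  by rewrite ler_pdivrMr; lra.
have Hd' : `|pa - pz| <= pm * h by rewrite /h mulrA [_ / r]mulrAC.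
have paz : pz <= 2 * pa.
  have := ler_norm (pz - pa); rewrite distrC.
  have : pm * h <= 2 * pz * 64^-1 by apply: ler_pM => //; lra.
  lra.
have al : pm / pa <= 4 by rewrite ler_pdivrMr//; lra.
have ze : pm / pz <= 2 by rewrite ler_pdivrMr//; lra.
have dif : `|pm / pa - pm / pz| <= 8 * h.
  have -> : pm / pa - pm / pz = (pm / pa) * (pm / pz) * ((pz - pa) / pm).
    by field; rewrite !gt_eqF.
  rewrite 2!normrM (gtr0_norm (divr_gt0 pm0 pa0)) (gtr0_norm (divr_gt0 pm0 pz0)).
  have -> : 8 * h = 4 * 2 * h by ring.
  rewrite normrM normfV (gtr0_norm pm0) distrC.
  have [al0 ze0] := (ltW (divr_gt0 pm0 pa0), ltW (divr_gt0 pm0 pz0)).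
  apply: ler_pM => //; first exact: mulr_ge0.
  - by rewrite divr_ge0// ltW.
  - exact: ler_pM.
  by rewrite ler_pdivrMr// mulrC.
split => //; first by rewrite -mulrA.
by move: dif; rewrite ler_norml => /andP[]; lra.
Qed.

End projective.

(** * Cocompactness: enlarging and shrinking slabs *)

Section cocompact.
Context {R : realType} {n : nat} (O K : set 'rV[R]_n) (D r : R).
Hypotheses (sO : strictly_convex O)
  (OD : forall x y, O x -> O y -> `|x - y| <= D)
  (r0 : 0 < r) (Kr : forall k v, K k -> `|v| <= r -> O (k + v))
  (OK : forall m, O m -> exists A k,
    [/\ A \in unitmx, preserves A O, K k & proj_act A k = m]).

Lemma cocompact_enlarge x0 : O x0 ->
  exists2 kap : R, 0 < kap <= 5^-1 & forall L,
    (forall x, O x -> 0 <= affine_eval L x) -> affine_eval L x0 = 1 ->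
    forall (s : R) a z, 0 < s <= 2^-1 -> O a -> O z ->
      affine_eval L a <= kap * s -> affine_eval L z <= kap * s ->
    O (z + s *: (x0 - z) + 4 *: (a - z)).
Proof.
move=> Ox0; have [_ [_ [cO _]]] := sO.1.
have D0 : 0 <= D by apply: le_trans (OD _ _ Ox0 Ox0).
have r_gt0 := r0; have rD : 0 < r + D by lra.
pose eta := r ^+ 2 / (64 * (r + D)).
have eta0 : 0 < eta by rewrite divr_gt0 ?exprn_gt0 ?mulr_gt0.
have [t t0 Ht] := strictly_convex_affine O D eta sO OD eta0.
(* The first bound forces the preimages of [a] and [z] to be [eta]-close. The second serves the slab
   induction, and makes [kap / 2] at most [1/4]. *)
pose kap := Num.min (t / (4 * (1 + D / r))) 5^-1.
have Dr0 : 0 <= D / r by rewrite divr_ge0// ltW.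
have kt : kap <= t / (4 * (1 + D / r)) by rewrite ge_min lexx.
have k0 : 0 < kap by rewrite lt_min invr_gt0 ltr0n andbT divr_gt0//; lra.
exists kap; first by rewrite k0 ge_min lexx orbT.
move=> L L0 L1 s a z /andP[s0 s2] Oa Oz La Lz.
pose m := z + s *: (x0 - z).
have mE : m = (1 - s) *: z + s *: x0 by apply/rowP => i; rewrite !mxE; ring.
have Om : O m by rewrite mE; apply: cO => //; lra.
have [A0 [m' [uA0 pA0 Km' Am'0]]] := OK _ Om.
have [A [uA p0 pA actE]] := preserves_pos O A0 cO uA0 pA0.
have Am' : proj_act A m' = m by rewrite actE.
have [[a' [Oa' Aa']] [z' [Oz' Az']]] := (pA.2 _ Oa, pA.2 _ Oz).
have [x' [Ox' Ax']] := pA.2 _ Ox0.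
have Om' : O m' by rewrite -[m']addr0; apply: Kr => //; rewrite normr0 ltW.
have [pa0 pz0 pm0 px0] := And4 (p0 _ Oa') (p0 _ Oz') (p0 _ Om') (p0 _ Ox').
have homE y' y : O y' -> proj_act A y' = y ->
    (proj_last A y')^-1 *: (homog y' *m A) = homog y.
  move=> /p0 /lt0r_neq0 py' <-; rewrite homog_mul//.
  by rewrite scalerA mulVf// scale1r.
set pa := proj_last A a' in pa0; set pz := proj_last A z' in pz0.
set pm := proj_last A m' in pm0; set px := proj_last A x' in px0.
have [Ha Hz Hm Hx] :=
  And4 (homE _ _ Oa' Aa') (homE _ _ Oz' Az') (homE _ _ Om' Am') (homE _ _ Ox' Ax').
rewrite -/pa -/pz -/pm -/px in Ha Hz Hm Hx.
have lip := affine_nonneg_lipschitz O (rsubmx A) m' r _ r0 (fun v => Kr _ v Km').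
have {}lip x y : `|proj_last A x - proj_last A y| <= pm / r * `|x - y|.
  rewrite !proj_lastE /pm proj_lastE; apply: lip => u Ou.
  by rewrite -proj_lastE ltW// p0.
have pub y' : O y' -> proj_last A y' <= pm * (1 + D / r).
  move=> Oy'; have H1 := le_trans (ler_norm _) (lip y' m').
  have H2 : pm / r * `|y' - m'| <= pm / r * D.
    by apply: ler_wpM2l (OD _ _ Oy' Om'); rewrite divr_ge0// ltW.
  rewrite -/pm in H1; have -> : pm * (1 + D / r) = pm / r * D + pm by field; lra.
  lra.
have Lsmall y' y : O y' -> proj_act A y' = y -> affine_eval L y <= kap * s ->
    affine_eval (A *m L) y' <= t / 4 * (pm * s).
  move=> Oy' <- Ly.
  have py' := p0 _ Oy'; rewrite affine_eval_mul ?gt_eqF//.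
  have -> : t / 4 * (pm * s) = pm * (1 + D / r) * (t / (4 * (1 + D / r)) * s).
    by field; rewrite !gt_eqF//; nra.
  apply: ler_pM; [exact: ltW | exact: (L0 _ (pA.1 _ Oy').2) | exact: pub |].
  by apply: le_trans Ly _; rewrite ler_wpM2r// ltW.
(* Otherwise the pulled-back functional has sum at least [t * (pm * s)] at [a'] and [z'], since
   [s <= affine_eval L m]; [Lsmall] bounds this sum by half of that. *)
have az' : `|a' - z'| < eta.
  rewrite ltNge; apply/negP => az'.
  have := Ht (A *m L) _ a' z' m' Oa' Oz' Om' az'.
  have := Lsmall _ _ Oa' Aa' La; have := Lsmall _ _ Oz' Az' Lz.
  rewrite (affine_eval_mul A L m') ?gt_eqF// Am' => Hz' Ha' Hm'.
  have Lm : s <= affine_eval L m.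
    by rewrite affine_shift L1; have := L0 _ Oz; nra.
  have : t * (pm * s) <= t * (pm * affine_eval L m).
    by rewrite !ler_pM2l.
  have tps : 0 < t * (pm * s) by rewrite !mulr_gt0.
  suff : t * (pm * affine_eval L m) <=
    affine_eval (A *m L) a' + affine_eval (A *m L) z' by lra.
  apply: Hm' => x Ox; rewrite affine_eval_mul ?gt_eqF ?p0//.
  by rewrite mulr_ge0//; [rewrite ltW// p0 | exact: (L0 _ (pA.1 _ Ox).2)].
(* Pull [m = (1 - s) z + s x0] back and compare last coordinates: both weights are nonnegative and
   sum to 1, so [pm * (1 - s) <= pz], with [s <= 1/2]. *)
have pmz : pm <= 2 * pz.
  have E : homog m' = (pm * (1 - s) / pz) *: homog z' + (pm * s / px) *: homog x'.
    apply: (can_inj (mulmxK uA)).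
    rewrite mulmxDl -!scalemxAl.
    have -> : homog m' *m A = pm *: homog m.
      by rewrite -Hm scalerA mulfV ?scale1r// gt_eqF.
    rewrite -!scalerA Hz Hx !scalerA.
    rewrite /m homog_shift.
    by apply/rowP => i; rewrite !mxE; ring.
  have := congr1 (fun w => rsubmx w 0 0) E.
  rewrite /= linearD !linearZ /= /homog !row_mxKr !mxE !mulr1 => E1.
  have : 0 <= pm * s / px by rewrite divr_ge0 ?mulr_ge0 ?ltW.
  have -> : pm * s / px = 1 - pm * (1 - s) / pz by lra.
  rewrite subr_ge0 ler_pdivrMr// mul1r; nra.
have := projective_weights r D pa pz pm r0 D0 pa0 pz0 pm0 pmz.
rewrite -/eta => /(_ _)[|al4 alze w2].
  apply: le_trans (lip a' z') _; rewrite ler_wpM2l ?(ltW az')//.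
  by rewrite divr_ge0 ?ltW.
set al := pm / pa in al4 alze w2; set ze := pm / pz in alze w2.
set w := 1 + 4 * (al - ze) in w2.
have w0 : 0 < w by lra.
have al0 : 0 < al by rewrite divr_gt0.
(* In homogeneous coordinates the preimage is [m' + 4 al a' - 4 ze z'], of total weight [w];
   normalise and subtract [m']. *)
pose v := w^-1 *: ((4 * al) *: (a' - z') + (4 * (al - ze)) *: (z' - m')).
have vr : `|v| <= r.
  rewrite normrZ normfV (gtr0_norm w0) mulrC ler_pdivrMr//.
  apply: (@le_trans _ _ (r * 2^-1)); last by rewrite ler_pM2l.
  apply: le_trans (ler_normD _ _) _; rewrite (normrZ (4 * al)) (normrZ (4 * (al - ze))).
  have -> : `|4 * al| = 4 * al by rewrite gtr0_norm// mulr_gt0.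
  have -> : `|4 * (al - ze)| = 4 * `|al - ze| by rewrite normrM ger0_norm.
  have H1 : 4 * al * `|a' - z'| <= 16 * eta.
    by apply: ler_pM => //; [lra | lra | exact: ltW].
  have H2 : 4 * `|al - ze| * `|z' - m'| <= 4 * (8 * eta / r) * D.
    by apply: ler_pM => //; [lra | exact: OD].
  have : 16 * eta + 4 * (8 * eta / r) * D <= r * 2^-1.
    have -> : r * 2^-1 = 32 * eta + 4 * (8 * eta / r) * D.
      by rewrite /eta; field; lra.
    by rewrite lerD2r ler_pM2r// ler_nat.
  lra.
have Ob' : O (m' + v) by exact: Kr.
(* [m' + v] is the image of [m + 4 *: (a - z)] under the inverse automorphism. *)
suff <- : proj_act A (m' + v) = m + 4 *: (a - z) by exact: (pA.1 _ Ob').2.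
apply: (@proj_act_homog _ _ _ _ _ (pm / w)).
  by rewrite gt_eqF// divr_gt0.
rewrite homog_shift -Ha -Hz -Hm.
have -> : homog (m' + v) = w^-1 *: (homog m' + (4 * al) *: homog a'
    - (4 * ze) *: homog z').
  have -> : m' + v = m' + (w^-1 * (4 * al)) *: (a' - z')
      + (w^-1 * (4 * (al - ze))) *: (z' - m').
    by rewrite /v scalerDr !scalerA addrA.
  rewrite !homog_shift; apply/rowP => i; rewrite !mxE /w; field.
  by rewrite gt_eqF.
rewrite -scalemxAl mulmxBl mulmxDl -!scalemxAl.
apply/rowP => i; rewrite !mxE /al /ze; field.
by rewrite !gt_eqF.
Qed.

(** Induction on [j]: the enlarged point lies in the previous slab, so [4 * |a - z|] is at most its
    diameter bound plus the shift towards [x0], together at most twice that bound. *)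
Lemma cocompact_slab_diam x0 : O x0 ->
  exists2 q : R, 0 < q <= 4^-1 & forall L,
    (forall x, O x -> 0 <= affine_eval L x) -> affine_eval L x0 = 1 ->
    forall (j : nat) a z, O a -> O z ->
      affine_eval L a <= q ^+ j -> affine_eval L z <= q ^+ j ->
    `|a - z| <= D * 2^-1 ^+ j.
Proof.
move=> Ox0; have [kap /andP[k0 k5] Hk] := cocompact_enlarge _ Ox0.
have D0 : 0 <= D by apply: le_trans (OD _ _ Ox0 Ox0).
(* [cocompact_enlarge] is applied with [s / 2], because [s = 1] at [j = 0] exceeds its range. *)
exists (kap / 2); first by apply/andP; split; lra.
move=> L L0 L1; elim=> [|j IH] a z Oa Oz La Lz.
  by rewrite expr0 mulr1; exact: OD.
set s := (kap / 2) ^+ j in IH.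
have s0 : 0 < s by rewrite exprn_gt0//; lra.
have sle : s <= 2^-1 ^+ j by rewrite lerXn2r ?nnegrE; lra.
have s1 : s <= 1.
  by apply: le_trans sle _; rewrite exprn_ile1//; lra.
rewrite exprS -/s in La Lz.
have Ob : O (z + (s / 2) *: (x0 - z) + 4 *: (a - z)).
  by apply: Hk L0 L1 _ _ _ _ Oa Oz _ _; lra.
have bz : `|z + (s / 2) *: (x0 - z) + 4 *: (a - z) - z| <= D * 2^-1 ^+ j.
  apply: IH => //.
    rewrite !affine_shift L1; have := L0 _ Oa; have := L0 _ Oz; nra.
  apply: le_trans Lz _; nra.
have : 4 * `|a - z| <= D * 2^-1 ^+ j + s / 2 * D.
  have -> : 4 * `|a - z| = `|4 *: (a - z)| by rewrite normrZ ger0_norm.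
  have -> : 4 *: (a - z) = (z + (s / 2) *: (x0 - z) + 4 *: (a - z) - z)
      - (s / 2) *: (x0 - z) by apply/rowP => i; rewrite !mxE; ring.
  apply: le_trans (ler_normB _ _) _; apply: lerD => //.
  rewrite normrZ ger0_norm; last lra.
  by apply: ler_wpM2l; [lra | exact: OD].
have : s / 2 * D <= D * 2^-1 ^+ j.
  by rewrite mulrC; apply: ler_wpM2l => //; lra.
rewrite exprS; lra.
Qed.

End cocompact.

(** * The Minkowski functional and membership in [O] *)

Lemma closure_ray_minkowski (R : realType) n (O : set 'rV[R]_n) x0 v (c : R) :
  open O -> convex_set_rV O -> O x0 -> 0 < c -> c < minkowski_fun O x0 v ->
  ~ closure O (x0 + c^-1 *: v).
Proof.
move=> oO cO Ox0 c0 cN clO.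
pose c1 := (c + minkowski_fun O x0 v) / 2.
have c10 : 0 < c1 by rewrite /c1; lra.
suff : minkowski_fun O x0 v <= c1 by rewrite /c1; lra.
apply: ge_inf; first by exists 0 => u [/ltW].
split => //.
have -> : x0 + c1^-1 *: v = (1 - c / c1) *: x0 + (c / c1) *: (x0 + c^-1 *: v).
  by apply/rowP => i; rewrite !mxE; field; rewrite !gt_eqF.
apply: convex_open_closure => //.
by rewrite divr_ge0 ?ltr_pdivrMr ?mul1r ?ltW// /c1; lra.
Qed.

Lemma minkowski_lt_mem (R : realType) n (O : set 'rV[R]_n) x0 v (c : R) :
  open O -> convex_set_rV O -> O x0 -> minkowski_fun O x0 v < c -> 0 < c ->
  O (x0 + c^-1 *: v).
Proof.
move=> oO cO Ox0 Nc c0; have [r r0 Hr] := open_ball_norm _ _ _ _ oO Ox0.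
have u0 : 0 < `|v| / r + 1 by rewrite ltr_wpDl// divr_ge0// ltW.
(* Nonemptiness comes from the ball around [x0]; without it [inf] would be a default value. *)
have hi : has_inf [set a : R | 0 < a /\ O (x0 + a^-1 *: v)].
  split; last by exists 0 => u [/ltW].
  exists (`|v| / r + 1); split => //.
  apply: Hr => //; rewrite normrZ normfV (gtr0_norm u0) mulrC ler_pdivrMr//.
  by rewrite mulrDr mulr1 mulrCA divff ?gt_eqF// mulr1 lerDl ltW.
have := inf_adherent _ hi => /(_ (c - minkowski_fun O x0 v)).
rewrite subr_gt0 => /(_ Nc)[u [{}u0 Ou]].
rewrite -/(minkowski_fun O x0 v) addrC subrK => uc.
have -> : x0 + c^-1 *: v = (1 - u / c) *: x0 + (u / c) *: (x0 + u^-1 *: v).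
  by apply/rowP => i; rewrite !mxE; field; rewrite !gt_eqF.
apply: cO => //; rewrite ler_pdivrMr// mul1r (ltW uc) andbT.
by rewrite divr_ge0// ltW.
Qed.

Lemma minkowski_le_norm (R : realType) n (O : set 'rV[R]_n) x0 v (r : R) :
  open O -> convex_set_rV O -> O x0 -> 0 < r ->
  (forall w, `|w| <= r -> O (x0 + w)) -> r * minkowski_fun O x0 v <= `|v|.
Proof.
move=> oO cO Ox0 r0 Hr; rewrite leNgt; apply/negP => vN.
have {}vN : `|v| / r < minkowski_fun O x0 v by rewrite ltr_pdivrMr// mulrC.
have v0 : 0 <= `|v| / r by rewrite divr_ge0// ltW.
pose c := (`|v| / r + minkowski_fun O x0 v) / 2.
have c0 : 0 < c by rewrite /c; lra.
have cN : c < minkowski_fun O x0 v by rewrite /c; lra.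
apply: (closure_ray_minkowski _ _ _ _ _ _ oO cO Ox0 c0 cN).
apply/subset_closure/Hr.
rewrite normrZ normfV (gtr0_norm c0) mulrC ler_pdivrMr// mulrC -ler_pdivrMr//.
by rewrite /c; lra.
Qed.

Lemma exists_half_expn_bracket (R : realType) (u : R) : 0 < u <= 1 ->
  exists j : nat, 2^-1 ^+ j < u <= 2 * 2^-1 ^+ j.
Proof.
move=> /andP[u0 u1].
have ex : exists j : nat, 2^-1 ^+ j < u.
  exists (Num.bound u^-1); rewrite exprVn invf_plt ?posrE ?exprn_gt0//.
  apply: lt_trans (archi_boundP _) _; first by rewrite invr_ge0 ltW.
  by rewrite -natrX ltr_nat ltn_expl.
case: (ex_minnP ex) => [[|j]] Hj jmin; first by move: Hj; rewrite expr0 ltNge u1.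
exists j.+1; rewrite Hj exprS mulrA divff// mul1r/= leNgt.
by apply/negP => /jmin; rewrite ltnn.
Qed.

Theorem theorem1p1 (R : realType) (n : nat) (O : set 'rV[R]_n) :
  strictly_convex O -> divisible O ->
  forall x0 : 'rV[R]_n, O x0 ->
  exists beta : R, 2 <= beta /\ uniformly_convex_pow (minkowski_fun O x0) beta.
Proof.
move=> sO [[_ [oO [cO [M OM]]]] [G [[_ [Gdet _]] [Gpres [K [cK [KO OG]]]]]]] x0 Ox0.
have [r r0 Kr] := compact_sub_open_ball _ _ K O cK oO KO.
have [r1 r10 x0r] := open_ball_norm _ _ _ _ oO Ox0.
(* Adding [r1] to the diameter bound makes [D] positive and later gives [u <= 1]. *)
pose D := 2 * M + r1.
have M0 : 0 <= M := le_trans (normr_ge0 _) (OM _ Ox0).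
have D0 : 0 < D by rewrite /D; lra.
have OD x y : O x -> O y -> `|x - y| <= D.
  move=> /OM Mx /OM My; apply: le_trans (ler_normB _ _) _; rewrite /D; lra.
have OK m : O m -> exists A k,
    [/\ A \in unitmx, preserves A O, K k & proj_act A k = m].
  move=> /OG[A GA [k Kk Ak]]; exists A, k; split => //; last exact: Gpres.
  by rewrite unitmxE unitfE -normr_eq0 Gdet// oner_neq0.
have [q /andP[q0 q4] Hq] := cocompact_slab_diam O K D r sO OD r0 Kr OK x0 Ox0.
have ln2 : 0 < ln (2 : R) by rewrite ln_gt0// ltr1n.
pose beta := - ln q / ln 2.
have qE : q = 2^-1 `^ beta.
  apply: ln_inj; rewrite ?posrE ?powR_gt0 ?invr_gt0//.
  by rewrite ln_powR lnV ?posrE// /beta; field; rewrite gt_eqF.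
have beta2 : 2 <= beta.
  rewrite /beta ler_pdivlMr// mulr_natl -lnXn// -lnV ?posrE// ler_ln ?posrE ?invr_gt0//.
  by rewrite -[leLHS]invrK lef_pV2 ?posrE ?invr_gt0//; lra.
have beta0 : 0 <= beta by lra.
exists beta; split => //.
pose c := r1 / (4 * D).
have c0 : 0 < c by rewrite divr_gt0// mulr_gt0.
pose C := Num.min (c `^ beta / 2) ((2 `^ beta)^-1 / 2).
have C0 : 0 < C by rewrite lt_min !divr_gt0// ?invr_gt0 ?powR_gt0.
exists C => // eps /andP[e0 e2] x y Nx Ny exy.
set N := minkowski_fun O x0 in Nx Ny exy *.
pose nu := N (x + y) / 2; rewrite -/nu.
set d := C * _.
have d0 : 0 <= d by rewrite mulr_ge0 ?powR_ge0// ltW.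
have d2 : d <= 2^-1.
  have : d <= (2 `^ beta)^-1 / 2 * 2 `^ beta.
    apply: ler_pM; rewrite ?powR_ge0// ?(ltW C0)//; first by rewrite ge_min lexx orbT.
    by apply: ge0_ler_powR; rewrite ?nnegrE.
  by rewrite mulrAC mulVf ?mul1r// gt_eqF// powR_gt0.
have dc : 2 * d <= (c * eps) `^ beta.
  rewrite powRM ?(ltW c0)// /d mulrA ler_wpM2r ?powR_ge0//.
  have : C <= c `^ beta / 2 by rewrite ge_min lexx.
  lra.
rewrite leNgt; apply/negP => nud.
have nu2 : 2^-1 < nu by lra.
have nu0 : 0 < nu by lra.
pose rho := (1 - d) / nu.
have rho1 : rho < 1 by rewrite ltr_pdivrMr//; lra.
have rho0 : 0 < rho by rewrite divr_gt0//; lra.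
(* Scaling by [th < 1] brings both points strictly inside [O], while [th ^+ 2 > rho] keeps
   [th ^+ 2 * nu] above [1 - d]. *)
pose th := (1 + rho) / 2.
have th1 : th < 1 by rewrite /th; lra.
have th2 : 2^-1 < th by rewrite /th; lra.
have th0 : 0 < th by lra.
have thnu : 1 - d < th ^+ 2 * nu.
  by rewrite -ltr_pdivrMr// -/rho /th; nra.
have Oth v : N v <= 1 -> O (x0 + th *: v).
  move=> Nv; rewrite -[th]invrK; apply: minkowski_lt_mem => //.
    by apply: le_lt_trans Nv _; rewrite invf_gt1.
  by rewrite invr_gt0.
have [Oa Oz] := (Oth _ Nx, Oth _ Ny).
have tn0 : 0 < 2 * th * nu by apply: mulr_gt0 => //; lra.
(* The point lies just beyond the exit of the ray through the midpoint, as [th < 1]; the functional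
   [L] will vanish there. *)
have ncl : ~ closure O (x0 + (2 * th * nu)^-1 *: (x + y)).
  apply: closure_ray_minkowski => //.
  have -> : minkowski_fun O x0 (x + y) = 2 * nu by rewrite /nu /N; field.
  nra.
have [L [L0 L1 Le]] := convex_open_separation O oO cO x0 _ (ex_intro _ M OM) Ox0 ncl.
rewrite -!/(affine_eval _ _) in L1 Le.
have shift k v (t : R) : affine_eval L (k + t *: v) =
    affine_eval L k + t * (affine_eval L (x0 + v) - 1).
  by rewrite -{1}(addrK x0 v) [v + x0]addrC affine_shift L1.
have Lxy : affine_eval L (x0 + x) - 1 + (affine_eval L (x0 + y) - 1) =
    - (2 * th * nu).
  move: Le; rewrite shift L1.
  have -> : x0 + (x + y) = x0 + x + 1 *: y by rewrite scale1r addrA.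
  rewrite shift => /(congr1 ( *%R (2 * th * nu))).
  by rewrite mulr0 mulrDr (mulVKf (lt0r_neq0 tn0)); lra.
have La := L0 _ Oa; have Lz := L0 _ Oz.
rewrite -!/(affine_eval _ _) in La Lz.
have Laz : affine_eval L (x0 + th *: x) + affine_eval L (x0 + th *: y) < 2 * d.
  rewrite !shift L1; nra.
(* If [eps = 0] then [d = 0], and [Laz] contradicts nonnegativity. *)
have eps0 : 0 < eps.
  rewrite lt_neqAle e0 andbT; apply/eqP => eE.
  have dE : d = 0 by rewrite /d -eE powR0 ?mulr0//; apply/eqP; lra.
  lra.
(* Chosen so that [D * u] is half of the lower bound [r1 * eps] for [|x - y|]. Since
   [c * eps = u / 2 <= 2^-j], both points lie in slab [j], which is too thin because [th > 1/2]. *)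
pose u := r1 * eps / (2 * D).
have u0 : 0 < u by rewrite divr_gt0 ?mulr_gt0.
have u1 : u <= 1.
  by rewrite ler_pdivrMr ?mulr_gt0// /D; nra.
have [|j /andP[ju uj]] := exists_half_expn_bracket _ u; first by rewrite u0.
have qj : (c * eps) `^ beta <= q ^+ j.
  rewrite qE -powR_mulrn ?powR_ge0// powRAC powR_mulrn ?invr_ge0//.
  apply: ge0_ler_powR => //; rewrite ?nnegrE ?exprn_ge0 ?invr_ge0//.
    by rewrite mulr_ge0// ltW.
  have -> : c * eps = u / 2 by rewrite /c /u; field; rewrite gt_eqF.
  lra.
have := Hq L L0 L1 j _ _ Oa Oz.
have -> : x0 + th *: x - (x0 + th *: y) = th *: (x - y).
  by rewrite opprD addrACA subrr add0r scalerBr.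
rewrite normrZ (gtr0_norm th0) => /(_ _ _) H.
have : th * `|x - y| <= D * 2^-1 ^+ j by apply: H; lra.
have : r1 * eps <= `|x - y|.
  apply: le_trans (minkowski_le_norm _ _ _ _ (x - y) _ oO cO Ox0 r10 x0r).
  by rewrite ler_pM2l.
have : D * 2^-1 ^+ j < r1 * eps / 2.
  have -> : r1 * eps / 2 = D * u by rewrite /u; field; rewrite gt_eqF.
  by rewrite ltr_pM2l.
have := normr_ge0 (x - y); nra.
Qed.
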